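(* For every positive integer $n$ and all nonnegative integers $a,b$, \[ \binom{an}{bn}_q \equiv \binom{a}{b}_{q^{n^2}} - (a-b)\,b\binom{a}{b}\frac{n^2-1}{24}(q^n-1)^2 \pmod{\Phi_n(q)^3}. \]
   Context: $[n]_q = 1+q+\cdots+q^{n-1}$, $[n]_q! = [n]_q\cdots[1]_q$, and $\binom{n}{k}_q = \frac{[n]_q!}{[k]_q![n-k]_q!}$ for $0\le k\le n$, with $\binom{n}{k}_q = 0$ if $k<0$ or $k>n$; $\binom{a}{b}_{q^{n^2}}$ is $\binom{a}{b}_q$ with $q$ replaced by $q^{n^2}$, and $\binom{a}{b}$ is the ordinary binomial coefficient. $\Phi_n(q)$ is the $n$th cyclotomic polynomial. A congruence $f\equiv g \pmod{\varphi(q)}$ means $f-g = h\varphi$ for some $h \in \mathbb{Q}[q^{\pm1}]$. *)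

(* Defs.v *)
From mathcomp Require Import all_boot all_order all_algebra all_field.

Set Implicit Arguments.
Unset Strict Implicit.
Unset Printing Implicit Defensive.

Import GRing.Theory.
Local Open Scope ring_scope.

Section QAnalogues.
Variable F : fieldType.

(* Taking the base x as an argument makes "replace q by q^m" the literal
   substitution x := q ^+ m.  The denominators below are nonzero when x is a
   power q ^+ m, m > 0, of the indeterminate of Q(q). *)
Definition qint (x : F) (n : nat) : F := \sum_(i < n) x ^+ i.

Definition qfact (x : F) (n : nat) : F := \prod_(i < n) qint x i.+1.

Definition qbinom (x : F) (n k : nat) : F :=
  if (k <= n)%N then qfact x n / (qfact x k * qfact x (n - k)) else 0.

End QAnalogues.

(* The field Q(q); the Laurent polynomials Q[q, 1/q] are a subring of it. *)
Definition ratfun : fieldType := {fraction {poly rat}}.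

Definition of_poly (p : {poly rat}) : ratfun := FracField.tofrac p.

Definition qvar : ratfun := of_poly 'X.

Definition is_laurent (h : ratfun) : Prop :=
  exists (p : {poly rat}) (k : nat), h = of_poly p / qvar ^+ k.

Definition cyclo (n : nat) : ratfun := of_poly (map_poly intr 'Phi_n).

Definition laurent_cong (phi f g : ratfun) : Prop :=
  exists2 h : ratfun, is_laurent h & f - g = h * phi.

(* Main.v *)
Require Import Defs.
From HB Require Import structures.
From mathcomp Require Import all_boot all_order all_algebra all_field.
From mathcomp Require Import ring.

(* Put u = q^n and P(t) = prod_(0 < r < n) (1 - t q^r).  Separating the
   multiples of n in [N n]_q! gives
     [N n]_q! = K^N [N]_u! prod_(k < N) P(u^k) / P(1),
   where the factor K^N cancels in the q-binomial coefficient.  Everything is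
   then expanded to second order in e = u - 1, with rational coefficients, in
   the local ring of Q(q) at a primitive n-th root of unity z; e lies in its
   maximal ideal.  For [N]_u! and [N]_(u^n)! this is routine.
   At q = z, P(t) = (1 - t^n) / (1 - t), which gives the Taylor coefficients of
   P at t = 1 modulo Phi_n.  The one at first order is needed modulo Phi_n^2;
   it comes from the reflection P(1/u) w = P(1) with
   w = prod_(0 < r < n) (- q^r), because w^2 = u^(n-1) and w = 1 at q = z.
   A difference of q-binomials is a polynomial in q, so that it is divisible by
   Phi_n^3 as soon as it is so in the local ring. *)

Set Implicit Arguments.
Unset Strict Implicit.
Unset Printing Implicit Defensive.

Import GRing.Theory.
Local Open Scope ring_scope.

(** * Second-order expansions in a local ring with principal maximal ideal *)

Definition ideal_pow (F : fieldType) (O : F -> Prop) (phi : F) (m : nat) (x : F) : Prop :=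
  exists2 y, O y & x = phi ^+ m * y.

(** The ring is a predicate on [F], so that quotients are computed in the field by [field] and only
    membership is tracked. The maximal ideal is [phi] times the ring, with rational constants
    embedded by [c]. *)
Record principal_local_ring (F : fieldType) (c : {rmorphism rat -> F})
    (O : F -> Prop) (phi : F) : Prop := PrincipalLocalRing {
  plr_rat : forall r, O (c r);
  plr_sub : forall x y, O x -> O y -> O (x - y);
  plr_mul : forall x y, O x -> O y -> O (x * y);
  plr_gen : O phi;
  plr_unit : forall x, O x -> ideal_pow O phi 1 x \/ O x^-1;
  plr_proper : ~ ideal_pow O phi 1 1 }.

Section LocalRing.

Context {F : fieldType} {c : {rmorphism rat -> F}} {O : F -> Prop} {phi : F}.
Hypothesis Oring : principal_local_ring c O phi.
Local Notation V := (ideal_pow O phi).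
Implicit Types (x y : F) (r : rat).

Lemma plr0 : O 0. Proof. by rewrite -(rmorph0 c); apply: (plr_rat Oring). Qed.
Lemma plr1 : O 1. Proof. by rewrite -(rmorph1 c); apply: (plr_rat Oring). Qed.
Lemma plr_opp x : O x -> O (- x).
Proof. by move=> Ox; rewrite -sub0r; apply: (plr_sub Oring) => //; apply: plr0. Qed.
Lemma plr_add x y : O x -> O y -> O (x + y).
Proof. by move=> Ox Oy; rewrite -(opprK y); apply: (plr_sub Oring) => //; apply: plr_opp. Qed.
Lemma plr_exp x m : O x -> O (x ^+ m).
Proof.
move=> Ox; elim: m => [|m IH]; first by rewrite expr0; apply: plr1.
by rewrite exprS; apply: (plr_mul Oring).
Qed.
Lemma plr_sum (I : Type) (s : seq I) (P : pred I) (f : I -> F) :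
  (forall i, P i -> O (f i)) -> O (\sum_(i <- s | P i) f i).
Proof. by move=> Of; apply: big_ind; [apply: plr0 | apply: plr_add | ]. Qed.
Lemma plr_prod (I : Type) (s : seq I) (P : pred I) (f : I -> F) :
  (forall i, P i -> O (f i)) -> O (\prod_(i <- s | P i) f i).
Proof. by move=> Of; apply: big_ind; [apply: plr1 | apply: (plr_mul Oring) | ]. Qed.

Ltac solve_mem := repeat first [assumption | exact: plr0 | exact: plr1
  | exact: (plr_gen Oring) | exact: (plr_rat Oring)
  | apply: (plr_sub Oring) | apply: plr_opp | apply: plr_add
  | apply: (plr_mul Oring) | apply: plr_exp].

Lemma ideal_pow_mem m x : V m x -> O x.
Proof. by case=> y Oy ->; solve_mem. Qed.
Lemma ideal_pow_add m x y : V m x -> V m y -> V m (x + y).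
Proof. by case=> a Oa -> [b Ob ->]; exists (a + b); [solve_mem | ring]. Qed.
Lemma ideal_pow_opp m x : V m x -> V m (- x).
Proof. by case=> a Oa ->; exists (- a); [solve_mem | ring]. Qed.
Lemma ideal_pow_sub m x y : V m x -> V m y -> V m (x - y).
Proof. by move=> Vx Vy; apply/ideal_pow_add/ideal_pow_opp. Qed.
Lemma ideal_pow_mul m k x y : V m x -> V k y -> V (m + k) (x * y).
Proof. by case=> a Oa -> [b Ob ->]; exists (a * b); [solve_mem | rewrite exprD; ring]. Qed.
Lemma ideal_pow_mull m x y : O x -> V m y -> V m (x * y).
Proof. by move=> Ox [b Ob ->]; exists (x * b); [solve_mem | ring]. Qed.
Lemma ideal_pow_mulr m x y : V m x -> O y -> V m (x * y).
Proof. by move=> Vx Oy; rewrite mulrC; apply: ideal_pow_mull. Qed.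
Lemma ideal_pow_le m k x : (m <= k)%N -> V k x -> V m x.
Proof.
move=> /subnKC <- [a Oa ->]; exists (phi ^+ (k - m) * a); first by solve_mem.
by rewrite exprD mulrA.
Qed.

(** If [x] were in the maximal ideal, so would be the nonzero rational [r], hence 1. *)
Lemma unit_of_residue x r : r != 0 -> V 1 (x - c r) -> O x^-1 /\ x != 0.
Proof.
move=> r0 Vx; have cr0 : c r != 0 by rewrite fmorph_eq0.
have Ox : O x by rewrite -(subrK (c r) x); apply/plr_add/(plr_rat Oring)/ideal_pow_mem/Vx.
have nVx : ~ V 1 x.
  move=> V1x; apply: (plr_proper Oring).
  have -> : 1 = c r^-1 * (x - (x - c r)) by rewrite fmorphV; field.
  by apply: ideal_pow_mull; [solve_mem | apply: ideal_pow_sub].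
split; first by case: (plr_unit Oring Ox).
by apply: contra_not_neq nVx => ->; exists 0; [solve_mem | rewrite mulr0].
Qed.

Variable e : F.
Hypothesis Ve : V 1 e.

(* [x = r0 + r1 e + r2 e^2] modulo the cube of the maximal ideal. *)
Definition jet (x : F) (r0 r1 r2 : rat) : Prop :=
  V 3 (x - (c r0 + c r1 * e + c r2 * e ^+ 2)).

Lemma param_mem : O e. Proof. exact: ideal_pow_mem Ve. Qed.
Hint Resolve param_mem : core.

Lemma jet_residue x r0 r1 r2 : jet x r0 r1 r2 -> V 1 (x - c r0).
Proof.
rewrite /jet => J; have Vx := ideal_pow_le (isT : (1 <= 3)%N) J.
have -> : x - c r0 = (x - (c r0 + c r1 * e + c r2 * e ^+ 2)) + (c r1 + c r2 * e) * e by ring.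
by apply: ideal_pow_add => //; apply: ideal_pow_mull => //; have Oe := param_mem; solve_mem.
Qed.

Lemma jet_mem x r0 r1 r2 : jet x r0 r1 r2 -> O x.
Proof.
move=> /jet_residue/ideal_pow_mem Ox; rewrite -(subrK (c r0) x).
by solve_mem.
Qed.

Lemma jet_cst r : jet (c r) r 0 0.
Proof. by exists 0; [solve_mem | rewrite rmorph0; ring]. Qed.

Lemma jet_nat k : jet k%:R k%:R 0 0.
Proof. by rewrite -(rmorph_nat c); apply: jet_cst. Qed.

Lemma jet_param : jet e 0 1 0.
Proof. by exists 0; [solve_mem | rewrite rmorph0 rmorph1; ring]. Qed.

Lemma jetD x y r0 r1 r2 s0 s1 s2 : jet x r0 r1 r2 -> jet y s0 s1 s2 ->
  jet (x + y) (r0 + s0) (r1 + s1) (r2 + s2).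
Proof.
move=> Jx Jy; have := ideal_pow_add Jx Jy; congr ideal_pow.
by rewrite !rmorphD; ring.
Qed.

Lemma jetN x r0 r1 r2 : jet x r0 r1 r2 -> jet (- x) (- r0) (- r1) (- r2).
Proof.
move=> Jx; have := ideal_pow_opp Jx; congr ideal_pow.
by rewrite !rmorphN; ring.
Qed.

Lemma jetB x y r0 r1 r2 s0 s1 s2 : jet x r0 r1 r2 -> jet y s0 s1 s2 ->
  jet (x - y) (r0 - s0) (r1 - s1) (r2 - s2).
Proof. by move=> Jx Jy; apply/jetD/jetN. Qed.

Lemma jetM x y r0 r1 r2 s0 s1 s2 : jet x r0 r1 r2 -> jet y s0 s1 s2 ->
  jet (x * y) (r0 * s0) (r0 * s1 + r1 * s0) (r0 * s2 + r1 * s1 + r2 * s0).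
Proof.
move=> Jx Jy; have Ox := jet_mem Jx; move: (param_mem) => Oe.
have V3 : V 3 (e ^+ 3).
  by rewrite exprS expr2; apply: (@ideal_pow_mul 1 2) => //; apply: (@ideal_pow_mul 1 1).
rewrite /jet; have -> : x * y - (c (r0 * s0) + c (r0 * s1 + r1 * s0) * e +
     c (r0 * s2 + r1 * s1 + r2 * s0) * e ^+ 2) =
  x * (y - (c s0 + c s1 * e + c s2 * e ^+ 2)) +
  (c s0 + c s1 * e + c s2 * e ^+ 2) * (x - (c r0 + c r1 * e + c r2 * e ^+ 2))
  + (c r1 * c s2 + c r2 * c s1 + c r2 * c s2 * e) * e ^+ 3.
  by rewrite !rmorphD !rmorphM; ring.
by apply: ideal_pow_add; [apply: ideal_pow_add|]; apply: ideal_pow_mull => //; solve_mem.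
Qed.

(** The truncated inverse series [y] makes [1 - x * y] vanish to third order. Multiplying by [x^-1],
    which is in the ring because its residue [r0] is nonzero, gives [x^-1 - y]. *)
Lemma jetV x r0 r1 r2 : r0 != 0 -> jet x r0 r1 r2 ->
  jet x^-1 r0^-1 (- r1 / r0 ^+ 2) ((r1 ^+ 2 - r0 * r2) / r0 ^+ 3).
Proof.
move=> nz Jx; have [Oxi x0] := unit_of_residue nz (jet_residue Jx).
set y := c r0^-1 + c (- r1 / r0 ^+ 2) * e + c ((r1 ^+ 2 - r0 * r2) / r0 ^+ 3) * e ^+ 2.
have Jy : jet y r0^-1 (- r1 / r0 ^+ 2) ((r1 ^+ 2 - r0 * r2) / r0 ^+ 3).
  by exists 0; [solve_mem | rewrite /y; ring].
have J1 := jetB (jet_nat 1) (jetM Jx Jy).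
rewrite /jet -/y; have -> : x^-1 - y = x^-1 * (1%:R - x * y) by field.
apply: ideal_pow_mull => //; move: J1; congr (V 3 _).
have -> : 1%:R - r0 * r0^-1 = 0 by field.
have -> : 0 - (r0 * (- r1 / r0 ^+ 2) + r1 / r0) = 0 by field.
have -> : 0 - (r0 * ((r1 ^+ 2 - r0 * r2) / r0 ^+ 3) + r1 * (- r1 / r0 ^+ 2) + r2 / r0) = 0.
  by field.
by rewrite rmorph0; ring.
Qed.

Lemma jet_eq x r0 r1 r2 s0 s1 s2 :
  jet x r0 r1 r2 -> r0 = s0 -> r1 = s1 -> r2 = s2 -> jet x s0 s1 s2.
Proof. by move=> J <- <- <-. Qed.

Lemma jet_sub x y r0 r1 r2 : jet x r0 r1 r2 -> jet y r0 r1 r2 -> V 3 (x - y).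
Proof.
move=> Jx Jy; have := ideal_pow_sub Jx Jy; congr ideal_pow; ring.
Qed.

Lemma jet_of_cong x y r0 r1 r2 : V 3 (x - y) -> jet y r0 r1 r2 -> jet x r0 r1 r2.
Proof.
move=> Vxy Jy; have := ideal_pow_add Vxy Jy; congr ideal_pow; ring.
Qed.

Lemma jet_exp x r1 r2 k : jet x 1 r1 r2 ->
  jet (x ^+ k) 1 (k%:R * r1) (k%:R * r2 + k%:R * (k%:R - 1) / 2%:R * r1 ^+ 2).
Proof.
move=> Jx; elim: k => [|k IH]; first by apply: jet_eq (jet_nat 1) _ _ _; rewrite //; ring.
rewrite exprS; apply: jet_eq (jetM Jx IH) _ _ _; rewrite -?(natr1 k); by field.
Qed.

Lemma jet_qint x r1 r2 k : jet x 1 r1 r2 ->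
  jet (qint x k) k%:R (k%:R * (k%:R - 1) / 2%:R * r1)
   (k%:R * (k%:R - 1) / 2%:R * r2 + k%:R * (k%:R - 1) * (k%:R - 2%:R) / 6%:R * r1 ^+ 2).
Proof.
rewrite /qint => Jx; elim: k => [|k IH].
  by rewrite big_ord0; apply: jet_eq (jet_nat 0) _ _ _; rewrite //; ring.
rewrite big_ord_recr /=.
by apply: jet_eq (jetD IH (jet_exp _ Jx)) _ _ _; rewrite -?(natr1 k); field.
Qed.

(** With y = x - 1, [j]_x = j (1 + (j-1)/2 y + (j-1)(j-2)/6 y^2 + ...); [A] and [B] are the
    coefficients of y and y^2 in the product of these parentheses for j <= k. The factorial stays in
    front, ready for [jet_quot]. *)
Lemma jet_qfact x r1 r2 k : jet x 1 r1 r2 ->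
  let A : rat := k%:R * (k%:R - 1) / 4%:R in
  let B : rat := k%:R * (k%:R - 1) * (k%:R - 2%:R) * (9%:R * k%:R + 13%:R) / (4%:R * 8%:R * 9%:R) in
  jet (qfact x k) k`!%:R (k`!%:R * (A * r1)) (k`!%:R * (A * r2 + B * r1 ^+ 2)).
Proof.
move=> Jx; elim: k => [|k IH] /=.
  by rewrite /qfact big_ord0; apply: jet_eq (jet_nat 1) _ _ _; rewrite ?(mul0r, mulr0, addr0).
rewrite /qfact big_ord_recr /= -/(qfact x k).
apply: jet_eq (jetM IH (jet_qint k.+1 Jx)) _ _ _;
  rewrite factS natrM -?(natr1 k); by field.
Qed.

(** Here [A] and [B] are the sums of k and k^2 for k < N, and [s ^+ 2 * (A ^+ 2 - B) / 2] is the
    second elementary symmetric function of the slopes s k. *)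
Lemma jet_prod (R : nat -> F) (s t1 t2 : rat) N :
  (forall k, jet (R k) 1 (s * k%:R) (t1 * k%:R + t2 * k%:R ^+ 2)) ->
  let A : rat := N%:R * (N%:R - 1) / 2%:R in
  let B : rat := N%:R * (N%:R - 1) * (2%:R * N%:R - 1) / 6%:R in
  jet (\prod_(k < N) R k) 1 (s * A)
    (t1 * A + t2 * B + s ^+ 2 * (A ^+ 2 - B) / 2%:R).
Proof.
move=> JR; elim: N => [|N IH] /=.
  by rewrite big_ord0; apply: jet_eq (jet_nat 1) _ _ _; rewrite //; field.
rewrite big_ord_recr /=.
by apply: jet_eq (jetM IH (JR N)) _ _ _; rewrite -?(natr1 N); field.
Qed.

(** The condition w = 1 at the residue level selects the root: for the candidate [z], w + z has
    residue 2 and is a unit, so w - z = (w^2 - z^2) / (w + z) is as small as w^2 - z^2. *)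
Lemma jet_sqrt w r1 r2 : O w -> V 1 (w - 1) -> jet (w ^+ 2) 1 r1 r2 ->
  jet w 1 (r1 / 2%:R) (r2 / 2%:R - r1 ^+ 2 / 8%:R).
Proof.
move=> Ow Vw Jw2.
have J1 := jet_nat 1.
set z := 1%:R + c (r1 / 2%:R) * e + c (r2 / 2%:R - r1 ^+ 2 / 8%:R) * e ^+ 2.
have Jz : jet z 1 (r1 / 2%:R) (r2 / 2%:R - r1 ^+ 2 / 8%:R).
  by exists 0; [solve_mem | rewrite /z rmorph1; ring].
have Vz := jet_residue Jz; rewrite rmorph1 in Vz.
have V2 : V 1 (w + z - c 2%:R).
  have -> : w + z - c 2%:R = (w - 1) + (z - 1) by rewrite rmorph_nat; ring.
  exact: ideal_pow_add.
have [Oi nz] := unit_of_residue (isT : (2%:R : rat) != 0) V2.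
apply: (jet_of_cong _ Jz).
have -> : w - z = (w + z)^-1 * (w ^+ 2 - z * z) by field.
apply: ideal_pow_mull => //; apply: jet_sub Jw2 _.
by apply: jet_eq (jetM Jz Jz) _ _ _; field.
Qed.

End LocalRing.

(** * q-integers, and the splitting of q-factorials into blocks of length n *)

Section QIntegers.

Context {F : fieldType}.
Implicit Types x q : F.

Lemma qint_geom x k : (1 - x) * qint x k = 1 - x ^+ k.
Proof. by rewrite /qint -opprB mulNr -subrX1 opprB. Qed.

Lemma qfactS x k : qfact x k.+1 = qfact x k * qint x k.+1.
Proof. by rewrite /qfact big_ord_recr. Qed.

Lemma qfactD x k l : qfact x (k + l) = qfact x k * \prod_(r < l) qint x (k + r.+1).
Proof.
elim: l => [|l IH]; first by rewrite addn0 big_ord0 mulr1.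
by rewrite addnS qfactS IH big_ord_recr /= addnS mulrA.
Qed.

Lemma qintD x k l : qint x (k + l) = qint x k + x ^+ k * qint x l.
Proof.
rewrite /qint big_split_ord /= mulr_sumr; congr (_ + _).
by apply: eq_bigr => i _; rewrite exprD.
Qed.

Lemma qintM x k l : qint x (k * l) = qint x k * qint (x ^+ k) l.
Proof.
elim: l => [|l IH]; first by rewrite muln0 /qint !big_ord0 mulr0.
rewrite mulnS addnC qintD IH [in RHS]/qint big_ord_recr /= -exprM mulrDr.
by rewrite [qint x k * x ^+ _]mulrC.
Qed.

(* [P(1 + y)] as a polynomial in [y], for [n = m.+1]. *)
Definition block_poly q m : {poly F} := \prod_(r < m) (1 - q ^+ r.+1 *: (1 + 'X)).

Lemma block_poly_horner q m y :
  (block_poly q m).[y - 1] = \prod_(r < m) (1 - q ^+ r.+1 * y).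
Proof.
rewrite /block_poly horner_prod; apply: eq_bigr => r _.
by rewrite hornerD hornerN hornerZ !hornerD hornerX !hornerC; ring.
Qed.

(** The (k+1)-st block contributes [n(k+1)]_q = [n]_q [k+1]_u and the factors [kn+r]_q = (1 - q^r
    u^k) / (1 - q) for 0 < r < n. *)
Lemma qfact_blocks q m k : q != 1 ->
  let u := q ^+ m.+1 in
  qfact q (k * m.+1) =
    (qint q m.+1 / (1 - q) ^+ m) ^+ k * (qfact u k * \prod_(i < k) (block_poly q m).[u ^+ i - 1]).
Proof.
move=> q1 u; have nz : 1 - q != 0 by rewrite subr_eq0 eq_sym.
elim: k => [|k IH]; first by rewrite mul0n /qfact !big_ord0 !mulr1 expr0.
rewrite mulSn addnC qfactD IH big_ord_recr [in RHS]big_ord_recr /= qfactS exprS.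
rewrite (_ : k * m.+1 + m.+1 = m.+1 * k.+1)%N; last by rewrite -mulSnr mulnC.
rewrite qintM -/u block_poly_horner.
have -> : \prod_(r < m) (1 - q ^+ r.+1 * u ^+ k) =
    (1 - q) ^+ m * \prod_(r < m) qint q (k * m.+1 + r.+1).
  have -> : (1 - q) ^+ m = \prod_(r < m) (1 - q) by rewrite prodr_const card_ord.
  rewrite -big_split /=.
  by apply: eq_bigr => r _; rewrite qint_geom exprD mulnC exprM mulrC.
set X := (\prod_(r < m) _); set Y := \prod_(i < k) _.
have nzm : (1 - q) ^+ m != 0 by apply: expf_neq0.
by field.
Qed.

(** Since q^r / u = q^-(n-r), multiplying 1 - q^r / u by - q^(n-r) gives 1 - q^(n-r); reversing the
    order of the second product pairs r with n - r. *)
Lemma block_poly_reflection q m : q != 0 ->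
  let u := q ^+ m.+1 in
  (block_poly q m).[u^-1 - 1] * \prod_(r < m) (- q ^+ r.+1) = (block_poly q m).[0].
Proof.
move=> q0 u; rewrite -[X in _ = _.[X]](subrr 1) !block_poly_horner.
rewrite [X in _ * X](reindex_inj rev_ord_inj) -big_split /=.
rewrite [RHS](reindex_inj rev_ord_inj) /=; apply: eq_bigr => r _.
have u0 : u != 0 by apply: expf_neq0.
have E : q ^+ r.+1 * q ^+ (m - r.+1).+1 = u.
  by rewrite -exprD addnS subnKC.
by rewrite mulr1 -E; field; rewrite !expf_neq0.
Qed.

Lemma prod_powers_sqr q m :
  (\prod_(r < m) (- q ^+ r.+1)) ^+ 2 = (q ^+ m.+1) ^+ m.
Proof.
rewrite expr2 [X in _ * X](reindex_inj rev_ord_inj) -big_split /=.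
have -> : (q ^+ m.+1) ^+ m = \prod_(r < m) q ^+ m.+1 by rewrite prodr_const card_ord.
by apply: eq_bigr => r _; rewrite mulrNN -exprD addnS subnKC.
Qed.

End QIntegers.

(** Identifies the coefficient of the theorem, an expression in the field, with the image of a
    rational: under [c] for the jets, under [cst] for constant polynomials. *)
Lemma rmorph_correction (F : fieldType) (f : {rmorphism rat -> F}) (x y z k : nat) :
  f ((x%:R - y%:R) * y%:R * z%:R * ((k%:R ^+ 2 - 1) / 24%:R)) =
  (x%:R - y%:R) * y%:R * z%:R * ((k%:R ^+ 2 - 1) / 24%:R).
Proof. by rewrite !(rmorphM, rmorphB, rmorph_nat, fmorphV, rmorphXn, rmorph1). Qed.

(** * The congruence in an abstract local ring *)

Section Congruence.

Context {F : fieldType} {c : {rmorphism rat -> F}} {O : F -> Prop} {phi : F}.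
Hypothesis Oring : principal_local_ring c O phi.
Local Notation V := (ideal_pow O phi).

Variables (q : F) (m : nat).
Local Notation n := m.+1.
Local Notation u := (q ^+ n).
Local Notation e := (u - 1).
Local Notation P := (block_poly q m).
Local Notation jet := (@jet F c O phi e).
Hypotheses (q0 : q != 0) (q_gen : forall k, (0 < k)%N -> q ^+ k != 1).
Hypotheses (Oq : O q) (Ve : V 1 e).
(** These are the coefficients of ((1+y)^n - 1) / y, the value of the block polynomial at a
    primitive n-th root of unity. *)
Hypothesis P_coef : forall i, V 1 (P`_i - c 'C(n, i.+1)%:R).

Lemma block_coef_mem i : O P`_i.
Proof.
rewrite -(subrK (c 'C(n, i.+1)%:R) P`_i); apply: (plr_add Oring).
  exact: (ideal_pow_mem Oring) (P_coef i).
exact: (plr_rat Oring).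
Qed.

Lemma block_poly_approx y : V 1 y -> V 3 (P.[y] - (P`_0 + P`_1 * y + P`_2 * y ^+ 2)).
Proof.
move=> Vy; have Oy := ideal_pow_mem Oring Vy.
(* Padding the size to at least three lets the first three coefficients be split off whatever the
   degree. *)
have [N leN] : exists N, (size P <= N.+3)%N by exists (size P); apply: leqW; apply: leqW.
rewrite (horner_coef_wide _ leN) !big_ord_recl /=.
set S := \sum_(i < N) _.
have -> : P`_0 * y ^+ 0 + (P`_1 * y ^+ 1 + (P`_2 * y ^+ 2 + S)) -
  (P`_0 + P`_1 * y + P`_2 * y ^+ 2) = S by ring.
rewrite /S; have -> : \sum_(i < N)
    P`_(bump 0 (bump 0 (bump 0 i))) * y ^+ (bump 0 (bump 0 (bump 0 i)))
   = \sum_(i < N) (P`_i.+3 * y ^+ i) * y ^+ 3.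
  by apply: eq_bigr => i _; rewrite /bump /= !add1n -mulrA -exprD addn3.
rewrite -mulr_suml; apply: (ideal_pow_mull Oring).
  apply: (plr_sum Oring) => i _; apply: (plr_mul Oring); first exact: block_coef_mem.
  exact: (plr_exp Oring).
rewrite exprS expr2.
by apply: (@ideal_pow_mul _ _ _ _ Oring 1 2) => //; apply: (@ideal_pow_mul _ _ _ _ Oring 1 1).
Qed.

(** The residues C(n,2)/n and C(n,3)/n of P_1/P_0 and P_2/P_0, where n = m + 1. *)
Let s : rat := m%:R / 2%:R.
Let r2 : rat := m%:R * (m%:R - 1) / 6%:R.

Lemma jet_u : jet u 1 1 0.
Proof.
have J : jet (e + 1) _ _ _ := jetD Oring (jet_param Oring e) (jet_nat Oring e 1).
by rewrite subrK in J; apply: jet_eq J _ _ _; ring.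
Qed.

Lemma rat_succ_neq0 : (n%:R : rat) != 0.
Proof. by rewrite Num.Theory.pnatr_eq0. Qed.

Lemma block_poly0_unit : O (P`_0)^-1 /\ P`_0 != 0.
Proof.
apply: (unit_of_residue Oring) (rat_succ_neq0) _; rewrite -[n in c n%:R]bin1; exact: P_coef.
Qed.

Lemma block_ratio_residue i (r : rat) : 'C(n, i.+1)%:R = n%:R * r ->
  V 1 (P`_i / P`_0 - c r).
Proof.
move=> E; have [Oi nz] := block_poly0_unit.
have -> : P`_i / P`_0 - c r = (P`_0)^-1 * ((P`_i - c 'C(n, i.+1)%:R)
   - c r * (P`_0 - c 'C(n, 1)%:R)).
  by rewrite bin1 E rmorphM; field.
apply: (ideal_pow_mull Oring) => //; apply: (ideal_pow_sub Oring) => //.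
by apply: (ideal_pow_mull Oring) => //; apply: (plr_rat Oring).
Qed.

Lemma bin2_rat k : ('C(k, 2)%:R : rat) = k%:R * (k%:R - 1) / 2%:R.
Proof.
case: k => [|k]; first by rewrite bin0n !mul0r.
have := mul_bin_diag k.+1 1; rewrite bin1 /= => /(congr1 (fun j => j%:R : rat)).
by rewrite !natrM -(natr1 k) => E; have -> : ('C(k.+1, 2)%:R : rat) = 2%:R * 'C(k.+1, 2)%:R / 2%:R;
  [field | rewrite -E; field].
Qed.

Lemma block_ratio1_residue : V 1 (P`_1 / P`_0 - c s).
Proof. by apply: block_ratio_residue; rewrite bin2_rat /s -(natr1 m); field. Qed.

Lemma block_ratio2_residue : V 1 (P`_2 / P`_0 - c r2).
Proof.
apply: block_ratio_residue.
have := mul_bin_diag n 2; rewrite /= => /(congr1 (fun j => j%:R : rat)).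
rewrite !natrM bin2_rat /r2 => E.
have -> : ('C(n, 3)%:R : rat) = 3%:R * 'C(n, 3)%:R / 3%:R by field.
by rewrite -E; field.
Qed.

Lemma block_ratio_mem i : O (P`_i / P`_0).
Proof.
by apply: (plr_mul Oring); [apply: block_coef_mem | case: block_poly0_unit].
Qed.

Lemma param_sqr : V 2 (e ^+ 2).
Proof. by rewrite expr2; apply: (@ideal_pow_mul _ _ _ _ Oring 1 1). Qed.

(** Residues may replace P_1/P_0 and P_2/P_0 only in front of [e ^+ 2]. In the linear term P_1/P_0
    is needed to one more order, so it is kept exact here and determined in [jet_block_slope]. *)
Lemma block_ratio_approx y k1 k2 : jet y 0 k1 k2 ->
  V 3 (P.[y] / P`_0 -
       (1 + c k1 * (P`_1 / P`_0 * e) + c (s * k2 + r2 * k1 ^+ 2) * e ^+ 2)).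
Proof.
move=> Jy; have [Oi nz] := block_poly0_unit.
have Vy : V 1 y by have := jet_residue Oring Ve Jy; rewrite rmorph0 subr0.
have Jy2 : jet (y * y) 0 0 (k1 ^+ 2).
  by apply: jet_eq (jetM Oring Ve Jy Jy) _ _ _; ring.
have V1 : V 3 ((P`_1 / P`_0 - c s) * e ^+ 2).
  by apply: (@ideal_pow_mul _ _ _ _ Oring 1 2) param_sqr; apply: block_ratio1_residue.
have V2 : V 3 ((P`_2 / P`_0 - c r2) * e ^+ 2).
  by apply: (@ideal_pow_mul _ _ _ _ Oring 1 2) param_sqr; apply: block_ratio2_residue.
have Oc := plr_rat Oring.
have VD := ideal_pow_add Oring; have VM := ideal_pow_mull Oring.
have VH := block_poly_approx Vy.
move: V1 V2; move: (s) (r2) => s' r' V1 V2.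
have := VD _ _ _ (VM _ _ _ Oi VH) (VD _ _ _ (VM _ _ _ (block_ratio_mem 1) Jy)
  (VD _ _ _ (VM _ _ _ (block_ratio_mem 2) Jy2)
  (VD _ _ _ (VM _ _ _ (Oc k2) V1) (VM _ _ _ (Oc (k1 ^+ 2)) V2)))).
by congr ideal_pow; rewrite !rmorphD !rmorphM !rmorph0; field.
Qed.

Lemma block_poly0E : P.[0] = P`_0. Proof. exact: horner_coef0. Qed.

Lemma jet_uinv : jet (u^-1 - 1) 0 (-1) 1.
Proof.
have J := jetV Oring Ve (isT : (1 : rat) != 0) jet_u.
by apply: jet_eq (jetB Oring J (jet_nat Oring e 1)) _ _ _; field.
Qed.

(** The square of the product w is u^m, whose jet is known. For the sign, 1/u has residue 1, so
    P(1/u) and P(1) agree modulo [phi]; as P(1) is a unit, the reflection P(1/u) w = P(1) forces w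
    to have residue 1. *)
Lemma jet_reflection_factor :
  jet (\prod_(r < m) (- q ^+ r.+1)) 1 s (s * (s - 1) / 2%:R).
Proof.
set w := \prod_(r < m) _.
have Ow : O w.
  by apply: (plr_prod Oring) => r _; apply: (plr_opp Oring); apply: (plr_exp Oring).
have Vy : V 1 (u^-1 - 1).
  by have := jet_residue Oring Ve jet_uinv; rewrite rmorph0 subr0.
have Oy := ideal_pow_mem Oring Vy.
have [Oi nz] := block_poly0_unit.
have VP : V 1 (P.[u^-1 - 1] - P`_0).
  have V3 := ideal_pow_le Oring (isT : (1 <= 3)%N) (block_poly_approx Vy).
  have O1 := block_coef_mem 1; have O2 := block_coef_mem 2.
  have := ideal_pow_add Oring V3 (ideal_pow_mulr Oring Vy
    (plr_add Oring O1 (plr_mul Oring O2 Oy))).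
  by congr ideal_pow; ring.
have E := block_poly_reflection m q0.
have Vw : V 1 (w - 1).
  have := ideal_pow_mull Oring Oi (ideal_pow_mulr Oring (ideal_pow_opp Oring VP) Ow).
  rewrite -/w block_poly0E in E.
  by congr ideal_pow; rewrite mulNr mulrBl E; field.
have Jw2 : jet (w ^+ 2) 1 (m%:R * 1) (m%:R * 0 + m%:R * (m%:R - 1) / 2%:R * 1 ^+ 2).
  by rewrite /w prod_powers_sqr; apply: (jet_exp Oring Ve _ jet_u).
by apply: jet_eq (jet_sqrt Oring Ve Ow Vw Jw2) _ _ _; rewrite // /s; field.
Qed.

(** At y = 1/u - 1 the ratio P(1/u) / P(1) is 1/w, known to second order; [block_ratio_approx] is
    then solved for its linear term. *)
Lemma jet_block_slope : jet (P`_1 / P`_0 * e) 0 s (r2 - s * (s - 1) / 2%:R).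
Proof.
have [Oi nz] := block_poly0_unit.
have E := block_poly_reflection m q0; rewrite block_poly0E in E.
have nzw : \prod_(r < m) (- q ^+ r.+1) != 0.
  by apply: contraNneq nz => w0; rewrite -E w0 mulr0.
have Jwi := jetV Oring Ve (isT : (1 : rat) != 0) jet_reflection_factor.
have A := block_ratio_approx jet_uinv.
have Ew : P.[u^-1 - 1] / P`_0 = (\prod_(r < m) (- q ^+ r.+1))^-1.
  by rewrite -[X in _ / X]E invfM mulVKf //; apply: contraNneq nz => y0; rewrite -E y0 mul0r.
rewrite Ew in A.
have Je := jet_param Oring e.
have J2 := jetM Oring Ve (jet_cst Oring e (s * 1 + r2 * (- 1) ^+ 2)) (jetM Oring Ve Je Je).
have J := jetD Oring (jetB Oring (jet_nat Oring e 1) Jwi) J2.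
apply: (jet_of_cong Oring) (jet_eq J _ _ _).
- move: A; congr ideal_pow; rewrite rmorphN rmorph1; ring.
- by field.
- by field.
- by field.
Qed.

(** Substitution of y = u^k - 1 and of the slope; the second-order coefficient is sorted by powers
    of k, as [jet_prod] expects. *)
Lemma jet_block k :
  jet (P.[u ^+ k - 1] / P`_0) 1 (s * k%:R)
    ((r2 - s ^+ 2 / 2%:R) * k%:R + (r2 + s / 2%:R) * k%:R ^+ 2).
Proof.
have Juk := jet_exp Oring Ve k jet_u.
have Jy : jet (u ^+ k - 1) 0 k%:R (k%:R * (k%:R - 1) / 2%:R).
  by apply: jet_eq (jetB Oring Juk (jet_nat Oring e 1)) _ _ _; field.
have A := block_ratio_approx Jy.
have Je := jet_param Oring e.
have J2 := jetM Oring Ve (jet_cst Oring e (s * (k%:R * (k%:R - 1) / 2%:R) + r2 * k%:R ^+ 2))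
  (jetM Oring Ve Je Je).
have J := jetD Oring (jetD Oring (jet_nat Oring e 1)
  (jetM Oring Ve (jet_cst Oring e k%:R) jet_block_slope)) J2.
apply: (jet_of_cong Oring) (jet_eq J _ _ _).
- by move: A; congr ideal_pow; rewrite expr2.
- by field.
- by field.
- by field.
Qed.

Lemma qint_neq0 j k : (0 < j)%N -> (0 < k)%N -> qint (q ^+ j) k != 0.
Proof.
move=> j0 k0; have jk : (0 < j * k)%N by rewrite muln_gt0 j0.
have := q_gen jk; rewrite exprM.
by apply: contraNneq => E; rewrite eq_sym -subr_eq0 -qint_geom E mulr0.
Qed.

Lemma qfact_neq0 j k : (0 < j)%N -> qfact (q ^+ j) k != 0.
Proof. by move=> j0; apply/prodf_neq0 => i _; apply: qint_neq0. Qed.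

Lemma jet_quot x y z f g h a1 a2 b1 b2 d1 d2 : f != 0 -> g != 0 ->
  jet x f (f * a1) (f * a2) -> jet y g (g * b1) (g * b2) -> jet z h (h * d1) (h * d2) ->
  let C := h / (f * g) in
  jet (z / (x * y)) C (C * (d1 - a1 - b1))
    (C * (d2 - a2 - b2 + a1 ^+ 2 + b1 ^+ 2 + a1 * b1 - d1 * (a1 + b1))).
Proof.
move=> f0 g0 Jx Jy Jz.
have Ji := jetV Oring Ve (mulf_neq0 f0 g0) (jetM Oring Ve Jx Jy).
by apply: jet_eq (jetM Oring Ve Jz Ji) _ _ _ => //; field; rewrite f0 g0.
Qed.

(** Writing a = b + d avoids truncated subtraction. Both sides become quotients of three terms with
    known jets. *)
Lemma qbinom_cong b d :
  V 3 (qbinom q ((b + d) * n) (b * n) -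
       (qbinom (q ^+ (n ^ 2)) (b + d) b
        - ((b + d)%:R - b%:R) * b%:R * 'C(b + d, b)%:R * ((n%:R ^+ 2 - 1) / 24%:R)
          * (q ^+ n - 1) ^+ 2)).
Proof.
have q1 : q != 1 := q_gen (isT : (0 < 1)%N).
have [Oi nz] := block_poly0_unit.
(* Dividing each block by P(1) makes its jet start at 1; the compensating P(1) goes into [K], which
   cancels because K^(b+d) = K^b K^d. *)
pose W k := qfact u k * \prod_(i < k) (P.[u ^+ i - 1] / P`_0).
pose K := qint q n / (1 - q) ^+ m * P`_0.
have EW k : qfact q (k * n) = K ^+ k * W k.
  rewrite (qfact_blocks m k q1) /K /W prodf_div prodr_const card_ord (exprMn k _ P`_0).
  have nzk : P`_0 ^+ k != 0 by apply: expf_neq0.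
  by rewrite -mulrA; congr (_ * _); field.
have JW k := jetM Oring Ve (jet_qfact Oring Ve k jet_u) (jet_prod Oring Ve k jet_block).
have JX k := jet_qfact Oring Ve k (jet_exp Oring Ve n jet_u).
have nzf k : (k`!%:R : rat) != 0 by rewrite Num.Theory.pnatr_eq0 -lt0n fact_gt0.
have nzWK k : K ^+ k * W k != 0 by rewrite -EW -[q in qfact q _]expr1 qfact_neq0.
have nzK : K != 0.
  by have := nzWK 1%N; rewrite expr1; apply: contraNneq => ->; rewrite mul0r.
have nzW k : W k != 0.
  by have := nzWK k; apply: contraNneq => ->; rewrite mulr0.
have -> : qbinom q ((b + d) * n) (b * n) = W (b + d)%N / (W b * W d).
  rewrite /qbinom leq_mul2r leq_addr orbT -mulnBl addKn !EW exprD.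
  have nzKb : K ^+ b != 0 by apply: expf_neq0.
  have nzKd : K ^+ d != 0 by apply: expf_neq0.
  move: (W b) (W d) (W _) (nzW b) (nzW d) => x y z nzx nzy; field.
  by apply/and4P; split.
(* The base q^(n^2) is u^n, so [jet_exp] supplies its jet. *)
rewrite {1}/qbinom leq_addr addKn -mulnn exprM.
pose A k : rat := k%:R * (k%:R - 1) / 2%:R.
pose A' k : rat := k%:R * (k%:R - 1) * (2%:R * k%:R - 1) / 6%:R.
pose B k : rat := k%:R * (k%:R - 1) * (k%:R - 2%:R) * (9%:R * k%:R + 13%:R) / (4%:R * 8%:R * 9%:R).
have {}JW k : jet (W k) k`!%:R (k`!%:R * (s * A k + A k / 2%:R))
  (k`!%:R * ((r2 - s ^+ 2 / 2%:R) * A k + (r2 + s / 2%:R) * A' k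
     + s ^+ 2 * (A k ^+ 2 - A' k) / 2%:R + s * A k ^+ 2 / 2%:R + B k)).
  by apply: jet_eq (JW k) _ _ _; rewrite ?mulr1 // /A /A' /B; field.
have JL := jet_quot (nzf b) (nzf d) (JW b) (JW d) (JW (b + d)%N).
have JR := jet_quot (nzf b) (nzf d) (JX b) (JX d) (JX (b + d)%N).
have Je := jet_param Oring e.
pose kappa : rat := d%:R * b%:R * ((b + d)`!%:R / (b`!%:R * d`!%:R)) * ((n%:R ^+ 2 - 1) / 24%:R).
have JR' := jetB Oring JR (jetM Oring Ve (jet_cst Oring e kappa) (jetM Oring Ve Je Je)).
have Ek : c kappa * (e * e) = ((b + d)%:R - b%:R) * b%:R * 'C(b + d, b)%:R
    * ((n%:R ^+ 2 - 1) / 24%:R) * e ^+ 2.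
  have -> : kappa = ((b + d)%:R - b%:R) * b%:R * 'C(b + d, b)%:R * ((n%:R ^+ 2 - 1) / 24%:R).
    rewrite /kappa -(bin_fact (leq_addr d b)) addKn !natrM natrD.
    by have := nzf b; have := nzf d => nzd nzb; field; rewrite nzb nzd.
  by rewrite rmorph_correction -expr2.
(* With the common binomial factor abstracted as [C], equality of the three coefficients becomes
   three polynomial identities in b, d and m. Those of order 0 and 1 hold without the correction,
   which enters only at order 2. *)
rewrite -Ek; apply: (jet_sub Oring JL); apply: (jet_eq JR'); rewrite /kappa /A /A' /B;
  move: (_ / (b`!%:R * _)) => C; rewrite /s /r2 ?natrD -?(natr1 m).
- by ring.
- by field.
- by field.
Qed.

End Congruence.

(** * The q-Pascal rule, and products over the n-th roots of unity *)

Lemma qbinom_pascal (F : fieldType) (x : F) n k :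
  (forall j, qfact x j != 0) ->
  qbinom x n.+1 k.+1 = qbinom x n k + x ^+ k.+1 * qbinom x n k.+1.
Proof.
(* For n < k all terms are 0 by convention; for k = n only the last one is, and the others are 1. *)
move=> nz; rewrite /qbinom ltnS subSS; case: ltngtP => [lt_kn|lt_nk|->]; last 2 first.
- by rewrite mulr0 addr0.
- by rewrite subnn mulr0 addr0 /qfact big_ord0 !mulr1 !divff // -/(qfact _ _).
have [d ->] : exists d, n = (k.+1 + d)%N by exists (n - k.+1)%N; rewrite subnKC.
rewrite addKn addSnnS addKn -addSnnS !qfactS -addnS qintD.
have nzk := nz k.+1; have nzd := nz d.+1; rewrite !qfactS !mulf_eq0 !negb_or in nzk nzd.
case/andP: nzk => ? ?; case/andP: nzd => ? ?.
by field; apply/and4P; split.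
Qed.

Lemma coef_one_addX_exp (R : comNzRingType) k i : ((1 + 'X : {poly R}) ^+ k)`_i = 'C(k, i)%:R.
Proof.
elim: k i => [|k IH] [|i]; rewrite ?expr0 ?coef1 ?bin0n // exprS mulrDl mul1r coefD coefXM IH /=.
  by rewrite !bin0 addr0.
by rewrite IH binS natrD.
Qed.

(** Each 1 - z^r X is - z^r (X - z^-r), and z^-1 is again primitive, so the product is a constant
    times X^n - 1. Evaluation at 0 shows that the constant is -1; then [t] is substituted for X. *)
Lemma prod_one_sub_root (F : fieldType) (z : F) n (t : {poly F}) : n.-primitive_root z ->
  \prod_(r < n) (1 - z ^+ r *: t) = 1 - t ^+ n.
Proof.
move=> prim; have n0 := prim_order_gt0 prim.
have z0 : z != 0.
  apply/eqP => z0; have /eqP := prim_expr_order prim.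
  by rewrite z0 expr0n gtn_eqF //= eq_sym oner_eq0.
have prim' : n.-primitive_root z^-1.
  have -> : z^-1 = z ^+ n.-1.
    by apply: (mulfI z0); rewrite divff // -exprS prednK // prim_expr_order.
  by rewrite prim_root_exp_coprime // -{2}(prednK n0) coprimenS.
pose a := \prod_(r < n) (- z ^+ r).
have E : \prod_(r < n) (1 - z ^+ r *: 'X) = a *: ('X^n - 1).
  rewrite -(factor_Xn_sub_1 prim') big_mkord -scaler_prod; apply: eq_bigr => r _.
  have zr : (z ^+ r)%:P * (z^-1 ^+ r)%:P = 1 :> {poly F}.
    by rewrite -polyCM -exprMn divff // expr1n.
  by rewrite -!mul_polyC polyCN -[in LHS]zr; ring.
have a1 : a = -1.
  have := congr1 (fun p => p.[0]) E; rewrite horner_prod big1 => [|r _].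
    rewrite hornerZ hornerD hornerN hornerXn expr0n gtn_eqF // hornerC sub0r mulrN1.
    by move/eqP; rewrite eq_sym eqr_oppLR => /eqP.
  by rewrite hornerD hornerN hornerZ hornerX mulr0 subr0 hornerC.
move: E => /(congr1 (comp_poly t)); rewrite rmorph_prod a1 scaleN1r opprB.
rewrite rmorphB rmorphXn rmorph1 /= comp_polyX => <-.
by apply: eq_bigr => r _; rewrite rmorphB rmorph1 /= comp_polyZ comp_polyX.
Qed.

(** For t = 1 + X the factor r = 0 of the full product is -X, which leaves X times the block
    polynomial equal to (1+X)^n - 1. *)
Lemma block_poly_root_coef (F : fieldType) (z : F) m i :
  m.+1.-primitive_root z -> (block_poly z m)`_i = 'C(m.+1, i.+1)%:R.
Proof.
move=> prim; have := prod_one_sub_root (1 + 'X) prim.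
rewrite big_ord_recl expr0 scale1r -/(block_poly z m) /= => E.
have {}E : 'X * block_poly z m = (1 + 'X) ^+ m.+1 - 1 by rewrite -opprB -E; ring.
have := congr1 (fun p : {poly F} => p`_i.+1) E.
by rewrite coefXM coefB coef_one_addX_exp coef1 subr0.
Qed.

HB.instance Definition _ := GRing.RMorphism.copy of_poly (@tofrac {poly rat}).

Lemma of_poly_inj : injective of_poly.
Proof. by move=> p q /eqP; rewrite tofrac_eq => /eqP. Qed.

(** * The local ring of Q(q) at a primitive n-th root of unity *)

Section Localization.

Variables (n : nat) (z : algC).
Hypothesis prim : n.-primitive_root z.

Definition eval_root : {rmorphism {poly rat} -> algC} := horner_eval z \o map_poly ratr.
Definition cst : {rmorphism rat -> ratfun} := @FracField.tofrac {poly rat} \o polyC.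
Local Notation ev := eval_root.
Local Notation PhiQ := (map_poly intr 'Phi_n : {poly rat}).

(** The localization of Q[q] at the prime ideal of polynomials vanishing at [z]. *)
Definition regular_at (x : ratfun) : Prop :=
  exists p s : {poly rat}, ev s != 0 /\ x = of_poly p / of_poly s.

(** Phi_n is the minimal polynomial of [z] over Q. *)
Lemma eval_root_eq0 p : (ev p == 0) = (PhiQ %| p).
Proof.
have [p0 [Ep0 _] dv] := minCpolyP z.
have -> : PhiQ = p0.
  apply: (map_poly_inj (ratr : {rmorphism rat -> algC}));
  rewrite /= -Ep0 (minCpoly_cyclotomic prim).
  rewrite -(Cintr_Cyclotomic prim) -map_poly_comp; apply: eq_map_poly => i /=.
  by rewrite ratr_int.
exact: dv.
Qed.

Lemma of_poly_eq0 p : (of_poly p == 0) = (p == 0).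
Proof. exact: tofrac_eq0. Qed.

Lemma eval_root_neq0 p : ev p != 0 -> of_poly p != 0.
Proof. by rewrite of_poly_eq0; apply: contra_neq => ->; apply: rmorph0. Qed.

Lemma regular_of_poly p : regular_at (of_poly p).
Proof. by exists p, 1; rewrite !rmorph1 oner_eq0 divr1. Qed.

Lemma ideal_of_poly p : ev p = 0 -> ideal_pow regular_at (cyclo n) 1 (of_poly p).
Proof.
move=> /eqP; rewrite eval_root_eq0 => /dvdpP[d ->].
exists (of_poly d); first exact: regular_of_poly.
by rewrite expr1 rmorphM mulrC.
Qed.

Lemma regular_local_ring : principal_local_ring cst regular_at (cyclo n).
Proof.
split.
- by move=> r; apply: (regular_of_poly r%:P).
- move=> _ _ [p [s [s0 ->]]] [p' [s' [s0' ->]]].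
  exists (p * s' - p' * s), (s * s'); split; first by rewrite rmorphM mulf_neq0.
  have nz := eval_root_neq0 s0; have nz' := eval_root_neq0 s0'.
  by rewrite rmorphB !rmorphM -[in LHS]mulNr addf_div // mulNr.
- move=> _ _ [p [s [s0 ->]]] [p' [s' [s0' ->]]].
  exists (p * p'), (s * s'); split; first by rewrite rmorphM mulf_neq0.
  have nz := eval_root_neq0 s0; have nz' := eval_root_neq0 s0'.
  by rewrite !rmorphM mulf_div.
- exact: regular_of_poly.
- move=> _ [p [s [s0 ->]]]; have [p0|p0] := eqVneq (ev p) 0; [left|right].
    have [y [a [b [b0 ->]]] ->] := ideal_of_poly p0.
    exists (of_poly a / of_poly (b * s)); first by exists a, (b * s); rewrite rmorphM mulf_neq0.
    by rewrite (rmorphM of_poly) invfM !mulrA.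
  by exists s, p; split=> //; rewrite invf_div.
(* If 1 = Phi_n p / s, then s = Phi_n p vanishes at [z], contrary to the choice of s. *)
- move=> [y [p [s [s0 ->]]]]; rewrite expr1 => E.
  have nz := eval_root_neq0 s0.
  have {}E : of_poly s = of_poly (PhiQ * p).
    by rewrite (rmorphM of_poly) -[LHS]mul1r E mulrA mulfVK.
  move/of_poly_inj: E => E; case/negP: s0.
  by rewrite eval_root_eq0 E dvdp_mulr.
Qed.

(** From f s = Phi_n^k p with s nonzero at [z], evaluation at [z] shows that Phi_n divides f;
    cancelling it lowers k by one. *)
Lemma cyclo_exp_dvd k (f : {poly rat}) :
  ideal_pow regular_at (cyclo n) k (of_poly f) -> exists h, f = h * PhiQ ^+ k.
Proof.
case=> y [p [s [s0 ->]]] E; have nz := eval_root_neq0 s0.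
have {}E : f * s = PhiQ ^+ k * p.
  by apply: of_poly_inj; rewrite !rmorphM rmorphXn /= E -!mulrA mulVf // mulr1.
have nzPhi : PhiQ != 0 by rewrite monic_neq0 // monic_map // Cyclotomic_monic.
elim: k f E => [|k IH] f E; first by exists f; rewrite expr0 mulr1.
have : ev f * ev s == 0.
  by rewrite -rmorphM E eval_root_eq0 exprS -mulrA dvdp_mulr.
rewrite mulf_eq0 (negPf s0) orbF eval_root_eq0 => /dvdpP[d Ed].
have [|h Eh] := IH d.
  by apply: (mulfI nzPhi); rewrite [RHS]mulrA -exprS -E Ed mulrCA mulrA.
by exists h; rewrite Ed Eh exprSr mulrA.
Qed.

Lemma eval_rootX : ev 'X = z.
Proof. by rewrite /= map_polyX /horner_eval hornerX. Qed.

(** A common source over Q[q], mapped to the block polynomials at q in Q(q) and at [z] in [algC]. *)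
Definition lifted_block_poly m : {poly {poly rat}} :=
  \prod_(r < m) (1 - 'X^(r.+1) *: (1 + 'X)).

Lemma map_lifted_block_poly (R : fieldType) (f : {rmorphism {poly rat} -> R}) m :
  map_poly f (lifted_block_poly m) = block_poly (f 'X) m.
Proof.
rewrite rmorph_prod; apply: eq_bigr => r _.
by rewrite rmorphB rmorph1 /= map_polyZ rmorphXn rmorphD rmorph1 /= map_polyX.
Qed.

End Localization.

(** * Verification of the hypotheses for Q(q), and descent to polynomials *)

Lemma block_poly_coef_residue m z i : m.+1.-primitive_root z ->
  ideal_pow (regular_at z) (cyclo m.+1) 1
    ((block_poly qvar m)`_i - cst 'C(m.+1, i.+1)%:R).
Proof.
(* Lifting to Q[q] makes the difference the image of a polynomial, which only has to vanish at
   [z]. *)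
move=> prim; rewrite -(map_lifted_block_poly of_poly) coef_map.
rewrite (_ : cst _ = of_poly 'C(m.+1, i.+1)%:R%:P) // -rmorphB /=.
apply: (ideal_of_poly prim); rewrite rmorphB -coef_map (map_lifted_block_poly (eval_root z)).
by rewrite eval_rootX block_poly_root_coef // polyC_natr rmorph_nat subrr.
Qed.

Lemma qvar_exp_neq1 k : (0 < k)%N -> qvar ^+ k != 1.
Proof.
move=> k0; rewrite /qvar -rmorphXn -(rmorph1 of_poly) (inj_eq of_poly_inj) -subr_eq0.
by rewrite -size_poly_eq0 size_XnsubC.
Qed.

Lemma qvar_neq0 : qvar != 0.
Proof. by rewrite of_poly_eq0 polyX_eq0. Qed.

(** Needed because [cyclo_exp_dvd] applies to polynomials; it follows from the q-Pascal rule by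
    induction on a. *)
Lemma qbinom_polynomial k a b : (0 < k)%N ->
  exists p, qbinom (qvar ^+ k) a b = of_poly p.
Proof.
move=> k0; elim: a b => [|a IH] [|b].
- by exists 1; rewrite /qbinom /qfact !big_ord0 mulr1 divr1 rmorph1.
- by exists 0; rewrite rmorph0.
- exists 1; rewrite /qbinom subn0 {2}/qfact big_ord0 mul1r divff ?rmorph1 //.
  by apply: qfact_neq0 => //; apply: qvar_exp_neq1.
rewrite qbinom_pascal; last by move=> j; apply: qfact_neq0 => //; apply: qvar_exp_neq1.
have [p ->] := IH b; have [p' ->] := IH b.+1.
exists (p + 'X^(k * b.+1) * p').
by rewrite rmorphD rmorphM rmorphXn exprM.
Qed.

Theorem theorem5 (n a b : nat) (n_gt0 : (0 < n)%N) :
  laurent_cong (cyclo n ^+ 3)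
    (qbinom qvar (a * n) (b * n))
    (qbinom (qvar ^+ (n ^ 2)) a b
     - (a%:R - b%:R) * b%:R * 'C(a, b)%:R * ((n%:R ^+ 2 - 1) / 24%:R)
       * (qvar ^+ n - 1) ^+ 2).
Proof.
(* For a < b both q-binomials and the ordinary one are 0, so h = 0 works. *)
case: (ltnP a b) => [lt_ab|].
  exists 0; first by exists 0, 0; rewrite rmorph0 mul0r.
  rewrite /qbinom leq_pmul2r // leqNgt lt_ab /= bin_small //.
  by rewrite !(mulr0, mul0r, subr0).
case: n n_gt0 => // m _; move=> /subnKC <-; set d := (a - b)%N.
have [z prim] := C_prim_root_exists (ltn0Sn m).
have Oring := regular_local_ring prim.
have Ve : ideal_pow (regular_at z) (cyclo m.+1) 1 (qvar ^+ m.+1 - 1).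
  rewrite -rmorphXn -(rmorph1 of_poly) -rmorphB /=; apply: (ideal_of_poly prim).
  by rewrite rmorphB rmorphXn rmorph1 eval_rootX prim_expr_order // subrr.
have := qbinom_cong Oring qvar_neq0 qvar_exp_neq1 (regular_of_poly z 'X) Ve
  (fun i => block_poly_coef_residue i prim) b d.
(* The base q is treated as q^1, hence the [expr1]. *)
have [p] := qbinom_polynomial ((b + d) * m.+1) (b * m.+1) (ltn0Sn 0); rewrite expr1 => ->.
have [p' ->] := qbinom_polynomial (b + d) b (ltn0Sn _ : (0 < m.+1 ^ 2)%N).
set r := (_ - _) * _ * _ * _.
have -> : r = of_poly ((((b + d)%:R - b%:R) * b%:R * 'C(b + d, b)%:R
    * ((m.+1%:R ^+ 2 - 1) / 24%:R) : rat)%:P).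
  exact: (esym (rmorph_correction cst _ _ _ _)).
have -> : (qvar ^+ m.+1 - 1) ^+ 2 = of_poly (('X^(m.+1) - 1) ^+ 2).
  by rewrite rmorphXn rmorphB rmorphXn rmorph1.
rewrite -(rmorphM of_poly) -!(rmorphB of_poly) /=.
move=> /(cyclo_exp_dvd prim) [h E].
(* The cofactor is even a polynomial, so the power of q in its denominator is 0. *)
exists (of_poly h); last by rewrite -(rmorphB of_poly) /= E rmorphM rmorphXn.
by exists h, 0%N; rewrite expr0 divr1.
Qed.
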